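(* Let $\pi=v\cdot u\in B_n$ with $$v=\tau_{i_1}^{-i_1},\qquad u=\tau_{i_2}^{k_2}\cdots\tau_{i_m}^{k_m},$$ where $1\le i_1\le n$ (so $v$ is the longest element of the parabolic subgroup generated by $\{s_0,s_1,\dots,s_{i_1-1}\}$), $u$ is an element of $\dot S_n$ presented by its generalized standard $OGS$ presentation, and $i_2\ge i_1$. Then the descent set of $\pi$ satisfies the following: - for $0\le j<i_1$: $j\in des(v\cdot u)\iff j\notin des(u)$; - for $j>i_1$: $j\in des(v\cdot u)\iff j\in des(u)$; - $i_1\notin des(v\cdot u)$.
   Context: $B_n$ is the group of signed permutations, i.e. the bijections $\pi$ of $\{\pm1,\dots,\pm n\}$ with $\pi(-i)=-\pi(i)$. It is a Coxeter group with generators $s_0,\dots,s_{n-1}$, where $s_0$ exchanges $1$ and $-1$, and for $1\le i\le n-1$, $s_i$ exchanges $i$ with $i+1$ and $-i$ with $-(i+1)$. Products are read from left to right: $(\pi_1\cdot\pi_2)(i)=\pi_2(\pi_1(i))$. $\dot S_n$ is the subgroup generated by $s_1,\dots,s_{n-1}$. For $1\le k\le n$, $\tau_k=s_0s_1\cdots s_{k-1}$. Every element of $B_n$ has a unique presentation $\tau_1^{e_1}\cdots\tau_n^{e_n}$ with integers $-k\le e_k<k$, called its generalized standard $OGS$ presentation; it is written omitting trivial factors, with strictly increasing subscripts (here $i_2<\dots<i_m$, with exponents $k_2,\dots,k_m$). The descent set is $des(\pi)=\{0\le i\le n-1:\pi(i)>\pi(i+1)\}$ with $\pi(0):=0$;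 equivalently $i\in des(\pi)$ iff $\ell(s_i\cdot\pi)<\ell(\pi)$, where $\ell$ is the Coxeter length. *)

(* Defs.v *)
From HB Require Import structures.
From mathcomp Require Import all_boot all_order all_algebra all_fingroup.

Set Implicit Arguments.
Unset Strict Implicit.
Unset Printing Implicit Defensive.

Import Order.TTheory GRing.Theory Num.Theory.

Local Open Scope ring_scope.

(* The finite set {±1, ..., ±n}: (b, i) encodes (-1)^b * (i + 1). *)
Notation letter n := (bool * 'I_n)%type.

Definition letter_val n (x : letter n) : int := (-1) ^+ x.1 * x.2.+1%:Z.

Definition letter_opp n (x : letter n) : letter n := (~~ x.1, x.2).

(* In {perm _}, (p * q) x = q (p x): products are read from left to right. *)
Definition hyperoct n : {set {perm letter n}} :=
  [set p : {perm letter n} | [forall x, p (letter_opp x) == letter_opp (p x)]].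

Lemma hyperoct_group_set n : group_set (hyperoct n).
Proof.
apply/group_setP; split=> [|p q].
  by rewrite inE; apply/forallP=> x; rewrite !perm1.
rewrite !inE => /forallP pP /forallP qP; apply/forallP=> x.
by rewrite !permM (eqP (pP x)) (eqP (qP _)).
Qed.

Canonical hyperoct_group n := Group (hyperoct_group_set n).

(* For 0 < i, the ordinals ord_pred i and i (of values i - 1 and i) encode the
   positive letters i and i + 1. *)
Definition coxgen n (i : 'I_n) : {perm letter n} :=
  if val i == 0%N then tperm (false, i) (true, i)
  else (tperm (false, ord_pred i) (false, i) *
        tperm (true, ord_pred i) (true, i))%g.

(* Hence the elements generated by the coxgen i, among them tau k, are in
   hyperoct n. *)
Lemma coxgen_hyperoct n (i : 'I_n) : coxgen i \in hyperoct n.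
Proof.
have oI : injective (@letter_opp n) by move=> [b j] [c k] [/negb_inj-> ->].
have tE (b c : bool) (j k l : 'I_n) :
    tperm (b, j) (b, k) (c, l) = (c, if b == c then tperm j k l else l).
  case: eqP => [<-|/eqP bc]; last by rewrite tpermD // xpair_eqE (negPf bc).
  have bI : injective (pair b : 'I_n -> letter n) by move=> ? ? [].
  by rewrite (inj_tperm _ _ _ bI).
rewrite inE /coxgen; apply/forallP=> -[b x]; apply/eqP.
case: ifP => _; first by rewrite (inj_tperm _ _ _ oI) tpermC.
by rewrite !permM; case: b; rewrite /letter_opp !tE.
Qed.

(* The copy of S_n generated by s_1, ..., s_(n-1). *)
Definition symm_subgroup n : {group {perm letter n}} :=
  <<[set coxgen i | i : 'I_n & (0 < i)%N]>>%G.

(* s_0 s_1 ... s_(k-1), for k <= n. *)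
Definition tau n (k : nat) : {perm letter n} :=
  (\prod_(i < n | (i < k)%N) coxgen i)%g.

Definition expgz (gT : finGroupType) (x : gT) (e : int) : gT :=
  match e with Posz m => (x ^+ m)%g | Negz m => (x ^- m.+1)%g end.

(* w = [:: (k_1, e_1); ...; (k_r, e_r)] stands for the word
   tau_(k_1)^(e_1) ... tau_(k_r)^(e_r), trivial factors being omitted. *)
Definition std_ogs n (w : seq (nat * int)) : bool :=
  sorted ltn (unzip1 w) &&
  all (fun f : nat * int =>
    [&& (0 < f.1 <= n)%N, - f.1%:Z <= f.2 < f.1%:Z & f.2 != 0]) w.

Definition ogs_eval n (w : seq (nat * int)) : {perm letter n} :=
  (\prod_(f <- w) expgz (tau n f.1) f.2)%g.

(* pi(i) as an integer, with pi(0) = 0; the value 0 for n < i is a dummy. *)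
Definition perm_at n (p : {perm letter n}) (i : nat) : int :=
  if i is i'.+1 then
    if insub i' is Some j then letter_val (p (false, j : 'I_n)) else 0
  else 0.

Definition des n (p : {perm letter n}) : {pred nat} :=
  [pred i | (i < n)%N && (perm_at p i.+1 < perm_at p i)].

(* Main.v *)
Require Import Defs.
From mathcomp Require Import all_boot all_order all_algebra all_fingroup.
Set Implicit Arguments.
Unset Strict Implicit.
Unset Printing Implicit Defensive.

(* The element tau_k^k negates the letters 1, ..., k and fixes the others,
   whereas u maps positive letters to positive ones. Thus pi(j) = - u(j) < 0 for
   j <= i_1 and pi(j) = u(j) > 0 for j > i_1: descents are exchanged with
   ascents below i_1, kept above i_1, and pi ascends at i_1. *)

Import Order.TTheory GRing.Theory Num.Theory.

Local Open Scope ring_scope.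

Lemma letter_val_opp n (x : letter n) :
  letter_val (letter_opp x) = - letter_val x.
Proof. by case: x => [[] j]; rewrite /letter_val /= ?mulN1r ?mul1r ?opprK. Qed.

Lemma letter_val_gt0 n (x : letter n) : (0 < letter_val x) = ~~ x.1.
Proof.
by case: x => [[] j]; rewrite /letter_val /= ?mulN1r ?mul1r ?oppr_gt0.
Qed.

(** The sign of the value determines the sign bit, its absolute value the index. *)
Lemma letter_val_inj n : injective (@letter_val n).
Proof.
move=> [b i] [c j] eq_val; congr pair.
  apply: negb_inj.
  by rewrite -[~~ b](letter_val_gt0 (b, i)) eq_val letter_val_gt0.
apply: val_inj; apply: succn_inj.
by have := congr1 absz eq_val; rewrite /letter_val !abszMsign.
Qed.

Lemma coxgen_succE n (i : 'I_n) (b : bool) (j : 'I_n) :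
  (0 < i)%N -> coxgen i (b, j) = (b, tperm (ord_pred i) i j).
Proof.
rewrite lt0n /coxgen => /negPf->.
have tE (c d : bool) (k l m : 'I_n) :
    tperm (c, k) (c, l) (d, m) = (d, if c == d then tperm k l m else m).
  case: eqP => [<-|/eqP cd]; last by rewrite tpermD // xpair_eqE (negPf cd).
  by rewrite (inj_tperm _ _ _ (fun x y (e : (c, x) = (c, y)) => congr1 snd e)).
by rewrite permM !tE; case: b.
Qed.

Lemma coxgen0E n (i : 'I_n) (b : bool) (j : 'I_n) :
  val i = 0%N -> coxgen i (b, j) = (b (+) (j == i), j).
Proof.
rewrite /coxgen => ->; rewrite eqxx.
have [->|ji] := eqVneq j i; last first.
  by rewrite addbF tpermD // xpair_eqE [i == j]eq_sym (negPf ji) andbF.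
by case: b; rewrite ?tpermL ?tpermR.
Qed.

Lemma tauS n k (lt_kn : (k < n)%N) :
  tau n k.+1 = (tau n k * coxgen (Ordinal lt_kn))%g.
Proof.
(* Narrowing both products to their true index ranges exposes the last factor. *)
rewrite /tau (big_ord_narrow lt_kn) (big_ord_narrow (ltnW lt_kn)) big_ord_recr.
congr (_ * coxgen _)%g; last exact: val_inj.
by apply: eq_bigr => i _; congr coxgen; apply: val_inj.
Qed.

(** [ord_pred] is cyclic; positivity rules out the wrap-around at 0. *)
Lemma val_ord_pred n (i : 'I_n) : (0 < i)%N -> val (ord_pred i) = i.-1.
Proof.
case: i => [[//|i] lt_in] _ /=.
by rewrite modnDr modn_small // ltnW.
Qed.

(** The factors of [tau n k] move only letters of index below k. *)
Lemma tau_fix n k (x : letter n) : (k <= n)%N -> (k <= x.2)%N -> tau n k x = x.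
Proof.
case: x => b j /=; elim: k => [|k IHk] le_kn lt_kj.
  by rewrite /tau big_pred0 ?perm1.
rewrite tauS permM IHk 1?ltnW //; have [k0 | k_gt0] := posnP k.
  by rewrite coxgen0E // -val_eqE /= gtn_eqF // addbF.
rewrite coxgen_succE // tpermD // -val_eqE ?val_ord_pred //= ltn_eqF //.
by rewrite (leq_ltn_trans (leq_pred k)).
Qed.

(** s_0 turns 1 into -1, which s_1, ..., s_(k-1) carry to -k; indices start at 0, so letter k has
    index k - 1. *)
Lemma tau_first n k (b : bool) (i j : 'I_n) : (k <= n)%N ->
  val i = 0%N -> k = j.+1 -> tau n k (b, i) = (~~ b, j).
Proof.
move=> le_kn i0; elim: k j le_kn => // k IHk j lt_kn [Dk].
have Dj : Ordinal lt_kn = j by apply: val_inj.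
rewrite tauS permM Dj; have [k0 | k_gt0] := posnP k.
  have -> : i = j by apply: val_inj; rewrite i0 -k0.
  have j0 : val j = 0%N by rewrite /= -Dk.
  by rewrite tau_fix ?k0 // coxgen0E // eqxx addbT.
have j_gt0 : (0 < j)%N by rewrite -Dk.
rewrite (IHk (ord_pred j) (ltnW lt_kn)).
  by rewrite coxgen_succE // tpermL.
by rewrite [nat_of_ord _]val_ord_pred // prednK.
Qed.

(** The factors before [coxgen i] fix the letter, [coxgen i] lowers its index to j, and the later
    factors move only indices above j. *)
Lemma tau_succ n k (b : bool) (i j : 'I_n) : (k <= n)%N ->
  val i = j.+1 -> (i < k)%N -> tau n k (b, i) = (b, j).
Proof.
move=> le_kn Di; have i_gt0 : (0 < i)%N by rewrite [nat_of_ord i]Di.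
have Dj : ord_pred i = j by apply: val_inj; rewrite val_ord_pred // Di.
elim: k le_kn => // k IHk lt_kn; rewrite ltnS leq_eqVlt tauS permM.
case/orP=> [/eqP Dk | lt_ik].
  have -> : Ordinal lt_kn = i by apply: val_inj.
  by rewrite tau_fix ?Dk ?(ltnW lt_kn) // coxgen_succE // Dj tpermR.
have lt_jk : (j.+1 < k)%N by rewrite -Di.
rewrite (IHk (ltnW lt_kn) lt_ik) coxgen_succE ?(leq_ltn_trans _ lt_ik) //.
rewrite tpermD // -val_eqE ?val_ord_pred ?(leq_ltn_trans _ lt_ik) //=.
  by rewrite gtn_eqF // -ltnS (ltn_predK lt_jk).
by rewrite gtn_eqF // ltnW.
Qed.

(** Each of the m steps starts at a positive index, so it lowers the index by one and keeps the
    sign. *)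
Lemma tau_expn_down n k m (b : bool) (i j : 'I_n) : (k <= n)%N ->
  val i = (m + j)%N -> (i < k)%N -> (tau n k ^+ m)%g (b, i) = (b, j).
Proof.
move=> le_kn; elim: m i => [|m IHm] i Di lt_ik.
  by rewrite expg0 perm1; congr pair; apply: val_inj.
have lt_mji : (m + j < i)%N by rewrite [nat_of_ord i]Di.
have lt_mj := ltn_trans lt_mji (ltn_ord i).
rewrite expgS permM (@tau_succ _ _ _ _ (Ordinal lt_mj)) //.
by rewrite IHm //= (ltn_trans lt_mji).
Qed.

(* Under tau_k, a letter i <= k descends to 1, jumps to -k and then climbs back
   to -i, which takes (i - 1) + 1 + (k - i) = k steps. *)
Lemma tau_expn_half n k (b : bool) (i : 'I_n) : (k <= n)%N ->
  (tau n k ^+ k)%g (b, i) = (b (+) (i < k)%N, i).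
Proof.
move=> le_kn; have [lt_ik | le_ki] := ltnP i k; last first.
  (* The induction is on the exponent alone; the subscript of [tau] stays k. *)
  rewrite addbF permX; elim: {1}k => //= m ->; exact: tau_fix.
have lt_0n : (0 < n)%N by case: n i {le_kn lt_ik} => [[]|].
have lt_k1n : (k.-1 < n)%N by case: k lt_ik le_kn.
have k_gt0 : (0 < k)%N by apply: leq_trans lt_ik.
have Dk : k = (i + (1 + (k.-1 - i)))%N.
  by rewrite add1n addnS subnKC ?prednK // -ltnS prednK.
rewrite {2}Dk !expgD !permM.
rewrite (@tau_expn_down _ _ _ _ _ (Ordinal lt_0n)) ?addn0 //.
rewrite expg1 (@tau_first _ _ _ _ (Ordinal lt_k1n)) ?prednK //=.
rewrite (@tau_expn_down _ _ _ _ _ i) ?addbT //=.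
  by rewrite subnK // -ltnS prednK.
by rewrite prednK.
Qed.

(** Flipping the signs at a fixed set of indices is an involution, so the inverse acts in the same
    way. *)
Lemma tau_expnN_half n k (b : bool) (i : 'I_n) : (k <= n)%N ->
  (tau n k ^- k)%g (b, i) = (b (+) (i < k)%N, i).
Proof.
move=> le_kn; apply: (@perm_inj _ (tau n k ^+ k)%g).
by rewrite permKV tau_expn_half // addbK.
Qed.

(** Each generator s_i with i > 0 preserves signs, hence so does every product of them. *)
Lemma symm_subgroup_sign n (p : {perm letter n}) (x : letter n) :
  p \in symm_subgroup n -> (p x).1 = x.1.
Proof.
case/gen_prodgP=> m [c cP ->]; move: x.
apply: (big_ind (fun p : {perm letter n} => forall x, (p x).1 = x.1)).
- by move=> x; rewrite perm1.
- by move=> q r qP rP x; rewrite permM rP qP.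
move=> j _ [b x]; have /imsetP[i] := cP j; rewrite inE => i_gt0 ->.
by rewrite coxgen_succE.
Qed.

Lemma symm_subgroup_hyperoct n : symm_subgroup n \subset hyperoct n.
Proof.
by rewrite gen_subG; apply/subsetP=> _ /imsetP[i _ ->]; apply: coxgen_hyperoct.
Qed.

Lemma perm_atS n (p : {perm letter n}) (j : nat) (lt_jn : (j < n)%N) :
  perm_at p j.+1 = letter_val (p (false, Ordinal lt_jn)).
Proof. by rewrite /perm_at insubT. Qed.

Lemma perm_at_symm_gt0 n (p : {perm letter n}) (j : nat) :
  p \in symm_subgroup n -> (0 < j <= n)%N -> 0 < perm_at p j.
Proof.
case: j => // j pS /andP[_ lt_jn].
by rewrite (perm_atS p lt_jn) letter_val_gt0 symm_subgroup_sign.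
Qed.

(** The sign change acts first, and [p] commutes with negation, so the sign moves outside. *)
Lemma perm_at_half_mul n k (p : {perm letter n}) (j : nat) :
    (k <= n)%N -> p \in hyperoct n ->
  perm_at (tau n k ^- k * p)%g j =
    if (j <= k)%N then - perm_at p j else perm_at p j.
Proof.
move=> le_kn; rewrite inE => /forallP pP.
case: j => [|j]; first by rewrite oppr0.
case: (ltnP j n) => [lt_jn | le_nj]; last first.
  (* Beyond n both sides are the dummy value 0. *)
  by rewrite /perm_at insubF ?oppr0 ?if_same // ltnNge le_nj.
rewrite !(perm_atS _ lt_jn) permM tau_expnN_half //=.
case: ifP => // _.
by rewrite -letter_val_opp -(eqP (pP _)).
Qed.

Theorem theorem6p0p3 (n i1 : nat) (w : seq (nat * int))
  (pi v u : {perm letter n}) :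
  (0 < i1 <= n)%N ->
  v = (tau n i1 ^- i1)%g ->
  std_ogs n w ->
  u = ogs_eval n w ->
  pi \in hyperoct n ->
  pi = (v * u)%g ->
  u \in symm_subgroup n ->
  (i1 <= head i1 (unzip1 w))%N ->
  [/\ forall j : nat, (j < i1)%N -> (j \in des pi) <-> (j \notin des u),
      forall j : nat, (i1 < j)%N -> (j \in des pi) <-> (j \in des u)
    & i1 \notin des pi].
Proof.
move=> /andP[i1_gt0 le_i1n] -> _ _ _ -> uS _.
have uH := subsetP (symm_subgroup_hyperoct n) u uS.
have u_gt0 j : (0 < j <= n)%N -> 0 < perm_at u j by apply: perm_at_symm_gt0.
split=> [j lt_ji | j lt_ij |]; rewrite !inE !perm_at_half_mul //.
- have lt_jn := leq_trans lt_ji le_i1n.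
  (* Both values are negated, so a descent of pi is a strict ascent of u; a non-descent of u is a
     priori only a weak one, so the values must be shown distinct. *)
  rewrite lt_ji (ltnW lt_ji) lt_jn /= ltrN2 -leNgt lt_neqAle.
  suff -> : perm_at u j != perm_at u j.+1 by [].
  (* At 0 the positivity of u(1) suffices; elsewhere u is injective. *)
  case: j => [|j] in lt_ji lt_jn *; first by rewrite lt_eqF ?u_gt0.
  have lt_jn' := ltnW lt_jn.
  rewrite (perm_atS u lt_jn) (perm_atS u lt_jn').
  rewrite (inj_eq (@letter_val_inj n)) (inj_eq perm_inj) xpair_eqE /=.
  by rewrite -val_eqE /= ltn_eqF.
- by rewrite (ltn_geF lt_ij) (ltn_geF (leqW lt_ij)).
(* If i1 = n, this position is outside the range of descents; otherwise pi(i1) <= 0 <= pi(i1 +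
   1). *)
rewrite leqnn ltnn; case: ltnP => // lt_i1n; rewrite andTb -leNgt.
apply: (@le_trans _ _ 0); last by apply/ltW/u_gt0.
by rewrite oppr_le0; apply/ltW/u_gt0; rewrite i1_gt0.
Qed.
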